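(* Let $k\ge1$. Consider a quasi-Newton method with exact linesearch applied to $\min_{x\in\mathbb{R}^n}\frac12x^THx+c^Tx$, where $H=H^T\succ0$, started at $x_0$ with $B_0=I$, in which $B_i=B_{i-1}+U_i$ for $1\le i\le k-1$, each $U_i$ being a well-defined member of the one-parameter Broyden family, and in which, for all $0\le i\le k-1$, $g_i\ne0$ and $p_i$ is a solution of $B_ip_i=-g_i$. Then the update matrix $U_k$ of the one-parameter Broyden family with parameter $\phi_k$ is always well-defined (that is, $p_{k-1}^THp_{k-1}\neq0$, $p_{k-1}^TB_{k-1}p_{k-1}\ne0$, and $\phi_k$ is a well-defined real number), unless $\phi_k$ is chosen as $\phi_k=\phi_k^{SR1}$ and the unit steplength $\alpha_{k-1}=1$ is taken in the same iteration. Here $\phi_k$ is allowed to be either any prescribed real number or the value given by the formula for $\phi_k^{SR1}$.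
   Context: Problem: minimize $q(x)=\frac12x^THx+c^Tx$ over $\mathbb{R}^n$ with $H=H^T\succ0$; gradient $g(x)=Hx+c$, $g_k=g(x_k)$. The method uses $x_{k+1}=x_k+\alpha_kp_k$ with exact linesearch $\alpha_k=-\frac{p_k^Tg_k}{p_k^THp_k}$. One-parameter Broyden family with parameter $\phi_k$: writing $p=p_{k-1}$, $B=B_{k-1}$, $$U_k=\frac{Hpp^TH}{p^THp}-\frac{Bpp^TB}{p^TBp}+\phi_k\,(p^TBp)\,ww^T,\qquad w=\frac{Hp}{p^THp}-\frac{Bp}{p^TBp}.$$ The Broyden parameter of the symmetric rank-one update (SR1) is $$\phi_k^{SR1}=\frac{p_{k-1}^THp_{k-1}}{p_{k-1}^T(H-B_{k-1})p_{k-1}},$$ which is undefined exactly when the denominator vanishes. ''Well-defined'' means that all denominators occurring in the formula for $U_k$ are nonzero and that $\phi_k$ itself is a defined real number. *)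

(* Defs.v *)
From mathcomp Require Import all_boot all_order all_algebra.
From mathcomp Require Import reals.

Set Implicit Arguments.
Unset Strict Implicit.
Unset Printing Implicit Defensive.

Import Order.TTheory GRing.Theory Num.Theory.
Local Open Scope ring_scope.

Section Defs.
Variables (R : realType) (n : nat).
Implicit Types (A B H U : 'M[R]_n) (c g p u v x : 'cV[R]_n) (phi : R).

Definition dot u v : R := (u^T *m v) 0 0.

Definition qform A p : R := dot p (A *m p).

Definition sym_posdef H : Prop :=
  H^T = H /\ forall v, v != 0 -> 0 < qform H v.

(* Gradient of x |-> 1/2 x^T H x + c^T x, for symmetric H. *)
Definition gradient H c x : 'cV[R]_n := H *m x + c.

Definition exact_step H g p : R := - (dot p g / qform H p).

(* A Broyden parameter is either a real number or the symbolic choice of the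
   SR1 formula; the latter has no value when its denominator vanishes, hence
   the option type below. *)
Inductive broyden_param : Type :=
  | Prescribed of R
  | SR1.

Definition param_value H B p (f : broyden_param) : option R :=
  match f with
  | Prescribed phi => Some phi
  | SR1 => if qform (H - B) p == 0 then None
           else Some (qform H p / qform (H - B) p)
  end.

Definition broyden_w H B p : 'cV[R]_n :=
  (qform H p)^-1 *: (H *m p) - (qform B p)^-1 *: (B *m p).

Definition broyden_update H B p phi : 'M[R]_n :=
  (qform H p)^-1 *: (H *m p *m p^T *m H)
  - (qform B p)^-1 *: (B *m p *m p^T *m B)
  + (phi * qform B p) *: (broyden_w H B p *m (broyden_w H B p)^T).

Definition update_well_defined H B p (f : broyden_param) : Prop :=
  [/\ qform H p != 0, qform B p != 0
    & exists phi, param_value H B p f = Some phi].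

Definition is_broyden_update H B p (f : broyden_param) U : Prop :=
  [/\ qform H p != 0, qform B p != 0
    & exists2 phi, param_value H B p f = Some phi
                 & U = broyden_update H B p phi].

(* The iterations 0, ..., k-1: they determine x_0, ..., x_k and
   B_0, ..., B_(k-1), whereas U_k and B_k are not yet formed.  The search
   direction p_i is any solution of its (possibly singular) linear system. *)
Record quasi_newton_run H c (k : nat) (x p : nat -> 'cV[R]_n)
    (B : nat -> 'M[R]_n) (f : nat -> broyden_param) : Prop := QuasiNewtonRun {
  qn_init : B 0%N = 1%:M;
  qn_grad_neq0 : forall i, (i < k)%N -> gradient H c (x i) != 0;
  qn_direction : forall i, (i < k)%N -> B i *m p i = - gradient H c (x i);
  qn_step : forall i, (i < k)%N ->
    x i.+1 = x i + exact_step H (gradient H c (x i)) (p i) *: p i;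
  qn_update : forall i, (1 <= i <= k.-1)%N ->
    exists2 U, is_broyden_update H (B i.-1) (p i.-1) (f i) U
             & B i = B i.-1 + U
}.

End Defs.

Arguments SR1 {R}.

(* Main.v *)
Require Import Defs.
From mathcomp Require Import all_boot all_order all_algebra.
From mathcomp Require Import reals.
Import Order.TTheory GRing.Theory Num.Theory.
Local Open Scope ring_scope.

Set Implicit Arguments.
Unset Strict Implicit.

(** Write g_i for the gradient at x_i.  By the secant equation, exact linesearch
    and symmetry, B_j p_a = H p_a for a < j, so the directions are H-conjugate
    and g_j is orthogonal to p_0, ..., p_(j-1); moreover B_j is the identity on
    the orthogonal complement of span(g_0, ..., g_j), so that p_j lies in
    span(g_0, ..., g_j).  If p_j were orthogonal to g_j, then p_j would lie in
    span(g_0, ..., g_(j-1)) = span(p_0, ..., p_(j-1)), and conjugacy would force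
    p_j = 0.  Hence p_j^T B_j p_j = - p_j^T g_j is nonzero, and the denominator
    of the SR1 parameter is p_j^T H p_j + p_j^T g_j, which vanishes exactly for
    the unit step. *)

Section Dot.
Context {R : realType} {n : nat}.
Implicit Types (A : 'M[R]_n) (u v z : 'cV[R]_n).

Lemma dotC u v : dot u v = dot v u.
Proof. by rewrite /dot -{1}[u^T *m v]trmxK trmx_mul trmxK mxE. Qed.

Lemma dotDr u v z : dot u (v + z) = dot u v + dot u z.
Proof. by rewrite /dot mulmxDr mxE. Qed.

Lemma dotNr u v : dot u (- v) = - dot u v.
Proof. by rewrite /dot mulmxN mxE. Qed.

Lemma dotZr a u v : dot u (a *: v) = a * dot u v.
Proof. by rewrite /dot -scalemxAr mxE. Qed.

Lemma dot_sym_mulmx A u v : A^T = A -> dot u (A *m v) = dot (A *m u) v.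
Proof. by move=> sA; rewrite /dot trmx_mul sA mulmxA. Qed.

Lemma mulmx_outer u v z : u *m v^T *m z = dot v z *: u.
Proof.
by rewrite -mulmxA [v^T *m z]mx11_scalar mul_mx_scalar.
Qed.

Lemma dot_gt0 v : v != 0 -> 0 < dot v v.
Proof.
move=> v0; have dE : dot v v = \sum_i v i 0 ^+ 2.
  by rewrite /dot mxE; apply: eq_bigr => i _; rewrite mxE expr2.
rewrite dE lt_neqAle sumr_ge0 ?andbT => [|i _]; last exact: sqr_ge0.
apply: contra_neq v0 => /esym/eqP.
rewrite psumr_eq0 => [/allP v0|i _]; last exact: sqr_ge0.
apply/colP => i; rewrite mxE; apply/eqP; rewrite -sqrf_eq0.
by apply: v0; rewrite mem_index_enum.
Qed.

End Dot.

Section Update.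
Context {R : realType} {n : nat}.
Variables (H B : 'M[R]_n) (p : 'cV[R]_n) (phi : R).
Hypotheses (sH : H^T = H) (sB : B^T = B).

Lemma broyden_update_mul v :
  broyden_update H B p phi *m v =
    ((qform H p)^-1 * dot (H *m p) v) *: (H *m p)
    - ((qform B p)^-1 * dot (B *m p) v) *: (B *m p)
    + (phi * qform B p * dot (broyden_w H B p) v) *: broyden_w H B p.
Proof.
have outerE A : A^T = A -> A *m p *m p^T *m A = A *m p *m (A *m p)^T.
  by move=> sA; rewrite trmx_mul sA mulmxA.
by rewrite /broyden_update !outerE // mulmxDl mulmxBl -!scalemxAl
  !mulmx_outer !scalerA.
Qed.

(** Each rank-one term has its right factor in the span of [H p] and [B p], since [w] is a
    combination of the two. *)
Lemma broyden_update_kernel v :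
  dot (H *m p) v = 0 -> dot (B *m p) v = 0 ->
  broyden_update H B p phi *m v = 0.
Proof.
move=> Hv Bv; have wv : dot (broyden_w H B p) v = 0.
  by rewrite dotC dotDr dotNr !dotZr !(dotC v) Hv Bv !mulr0 subr0.
by rewrite broyden_update_mul Hv Bv wv !mulr0 !scale0r subr0 addr0.
Qed.

(** As [w] is orthogonal to [p], the [phi] term vanishes at [p] whatever [phi] is. *)
Lemma broyden_update_secant :
  qform H p != 0 -> qform B p != 0 ->
  (B + broyden_update H B p phi) *m p = H *m p.
Proof.
move=> H0 B0; have wp : dot (broyden_w H B p) p = 0.
  by rewrite dotC dotDr dotNr !dotZr !mulVf // subrr.
by rewrite mulmxDl broyden_update_mul wp !(dotC _ p) !mulVf // mulr0 scale0r
  addr0 !scale1r addrC subrK.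
Qed.

Lemma broyden_update_sym :
  (broyden_update H B p phi)^T = broyden_update H B p phi.
Proof.
rewrite /broyden_update; move: (broyden_w H B p) => w.
by rewrite !linearD linearN !linearZ /= !trmx_mul !trmxK sH sB !mulmxA.
Qed.

End Update.

Section Run.
Context {R : realType} {n : nat}.
Variables (H : 'M[R]_n) (c : 'cV[R]_n) (k : nat) (x p : nat -> 'cV[R]_n).
Variables (B : nat -> 'M[R]_n) (f : nat -> broyden_param R).
Hypotheses (pdH : sym_posdef H) (run : quasi_newton_run H c k x p B f).

Let g i := gradient H c (x i).
Let alpha i := exact_step H (g i) (p i).

Let sH : H^T = H. Proof. by case: pdH. Qed.

Lemma direction_curvature_gt0 j : (j < k)%N -> 0 < qform H (p j).
Proof.
move=> jk; apply: (proj2 pdH); apply: contra_neq (qn_grad_neq0 run jk) => p0.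
by have := qn_direction run jk; rewrite p0 mulmx0 => /esym/eqP;
  rewrite oppr_eq0 => /eqP.
Qed.

Lemma gradient_step j : (j < k)%N -> g j.+1 = g j + alpha j *: (H *m p j).
Proof.
by move=> jk; rewrite /g /gradient (qn_step run jk) mulmxDr -scalemxAr addrAC.
Qed.

Lemma direction_next_gradient j : (j < k)%N -> dot (p j) (g j.+1) = 0.
Proof.
move=> jk; rewrite gradient_step // dotDr dotZr /alpha /exact_step mulNr.
by rewrite divfK ?subrr // gt_eqF // direction_curvature_gt0.
Qed.

Lemma qform_direction j : (j < k)%N -> qform (B j) (p j) = - dot (p j) (g j).
Proof. by move=> jk; rewrite /qform (qn_direction run jk) dotNr. Qed.

(* Inclusions between spans are stated dually, as reversed inclusions between
   orthogonal complements: [inv_id] gives range (B j - 1) <= span(g_0 .. g_j),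
   and [inv_span] gives span(g_0 .. g_(j-1)) <= span(p_0 .. p_(j-1)). *)
Record run_invariant (j : nat) : Prop := RunInvariant {
  inv_sym : (B j)^T = B j;
  inv_secant : forall a, (a < j)%N -> B j *m p a = H *m p a;
  inv_orth : forall a, (a < j)%N -> dot (p a) (g j) = 0;
  inv_id : forall v, (forall a, (a <= j)%N -> dot (g a) v = 0) -> B j *m v = v;
  inv_span : forall v, (forall a, (a < j)%N -> dot (p a) v = 0) ->
    forall a, (a < j)%N -> dot (g a) v = 0
}.

Section Invariant.
Variable j : nat.
Hypotheses (jk : (j < k)%N) (Ij : run_invariant j).

(** By symmetry and the secant equation the product equals [dot (p a) (B j *m p j)], and
    [B j *m p j] is minus the gradient. *)
Lemma conjugate a : (a < j)%N -> dot (p a) (H *m p j) = 0.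
Proof.
move=> aj; rewrite dot_sym_mulmx // -(inv_secant Ij) //.
rewrite -dot_sym_mulmx ?(inv_sym Ij) // (qn_direction run jk) dotNr.
by rewrite (inv_orth Ij) // oppr0.
Qed.

(** Dual form of: p_j lies in the span of g_0, ..., g_j. Such a [v] is fixed by [B j], which
    symmetry moves onto [p j]. *)
Lemma direction_orth v :
  (forall a, (a <= j)%N -> dot (g a) v = 0) -> dot (p j) v = 0.
Proof.
move=> gv; rewrite -(inv_id Ij gv) dot_sym_mulmx ?(inv_sym Ij) //.
by rewrite (qn_direction run jk) dotC dotNr dotC gv ?oppr0.
Qed.

(* Both sides express that p_j is orthogonal to the component of v orthogonal
   to g_j. *)
Lemma direction_dot v : (forall a, (a < j)%N -> dot (p a) v = 0) ->
  dot (p j) v = dot (g j) v / dot (g j) (g j) * dot (p j) (g j).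
Proof.
move=> pv; have gg : dot (g j) (g j) != 0.
  by rewrite gt_eqF // dot_gt0 // (qn_grad_neq0 run jk).
apply/eqP; rewrite -subr_eq0 -dotZr -dotNr -dotDr; apply/eqP.
apply: direction_orth => a; rewrite dotDr dotNr dotZr leq_eqVlt.
case/orP => [/eqP->|aj]; first by rewrite divfK // subrr.
by rewrite !(inv_span Ij _ aj) ?mulr0 ?subr0 //; exact: inv_orth.
Qed.

(** Conjugacy lets [direction_dot] be applied to [H *m p j], making the positive curvature a
    multiple of [dot (p j) (g j)]. *)
Lemma direction_gradient_neq0 : dot (p j) (g j) != 0.
Proof.
apply: contraTneq (direction_curvature_gt0 jk) => pg.
by rewrite /qform direction_dot ?pg ?mulr0 ?ltxx //; exact: conjugate.
Qed.

Lemma run_invariantS : (j.+1 < k)%N -> run_invariant j.+1.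
Proof.
move=> j1k; have [|U [H0 B0 [phi _ ->]] BE] := qn_update run (i := j.+1).
  by case: (k) j1k.
rewrite /= in H0 B0 BE; have sB := inv_sym Ij.
have orth a : (a < j.+1)%N -> dot (p a) (g j.+1) = 0.
  rewrite ltnS leq_eqVlt => /orP[/eqP->|aj]; first exact: direction_next_gradient.
  by rewrite gradient_step // dotDr dotZr (inv_orth Ij) // conjugate // mulr0 addr0.
split=> //.
- by rewrite BE linearD /= broyden_update_sym // sB.
- move=> a; rewrite ltnS leq_eqVlt BE => /orP[/eqP->|aj].
    exact: broyden_update_secant.
  (* Earlier directions are orthogonal to both H p_j and B_j p_j = - g_j, so the update keeps their
     secant equations. *)
  rewrite mulmxDl broyden_update_kernel ?addr0 //; first exact: inv_secant.
    by rewrite dotC conjugate.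
  by rewrite (qn_direction run jk) dotC dotNr (inv_orth Ij) // oppr0.
- move=> v gv; rewrite BE mulmxDl broyden_update_kernel ?addr0 //.
  + by apply: inv_id => // a aj; apply: gv; rewrite leqW.
  (* With a nonzero step, H p_j is a multiple of g_(j+1) - g_j, hence orthogonal to [v]. *)
  + have a0 : alpha j != 0.
      by rewrite oppr_eq0 mulf_neq0 ?invr_eq0 // direction_gradient_neq0.
    apply: (mulfI a0); rewrite mulr0 -(gv j.+1) // gradient_step //.
    by rewrite !(dotC _ v) dotDr dotZr (dotC v (g j)) gv // add0r.
  + by rewrite (qn_direction run jk) dotC dotNr dotC gv // oppr0.
- move=> v pv a; have pvj b : (b < j)%N -> dot (p b) v = 0.
    by move=> bj; apply: pv; rewrite ltnS ltnW.
  rewrite ltnS leq_eqVlt => /orP[/eqP->|]; last exact: inv_span.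
  have gg : dot (g j) (g j) != 0.
    by rewrite gt_eqF // dot_gt0 // (qn_grad_neq0 run jk).
  (* The left side is now 0, and on the right only [dot (g j) v] can vanish. *)
  have /eqP := direction_dot pvj; rewrite pv // eq_sym !mulf_eq0 invr_eq0.
  by rewrite (negPf gg) (negPf direction_gradient_neq0) !orbF => /eqP.
Qed.

End Invariant.

Lemma run_invariant_all j : (j < k)%N -> run_invariant j.
Proof.
elim: j => [|j IHj] jk; last first.
  exact: (run_invariantS (ltnW jk) (IHj (ltnW jk)) jk).
by split=> //; rewrite (qn_init run) ?trmx1 // => v _; rewrite mul1mx.
Qed.

End Run.

Theorem corollary3p9 (R : realType) (n : nat) (H : 'M[R]_n) (c : 'cV[R]_n)
    (k : nat) (x p : nat -> 'cV[R]_n) (B : nat -> 'M[R]_n)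
    (f : nat -> broyden_param R) :
  sym_posdef H ->
  (1 <= k)%N ->
  quasi_newton_run H c k x p B f ->
  ~ (f k = SR1 /\
     exact_step H (gradient H c (x k.-1)) (p k.-1) = 1) ->
  update_well_defined H (B k.-1) (p k.-1) (f k).
Proof.
move=> pdH k_gt0 run nSR1; set j := k.-1 in nSR1 *.
have jk : (j < k)%N by rewrite /j; case: (k) k_gt0.
have H0 : qform H (p j) != 0.
  by rewrite gt_eqF // (direction_curvature_gt0 pdH run).
have pg : dot (p j) (gradient H c (x j)) != 0.
  exact: (direction_gradient_neq0 pdH run jk (run_invariant_all pdH run jk)).
have BE := qform_direction run jk.
split; [by [] | by rewrite BE oppr_eq0 |].
case fk: (f k) => [phi|] /=; first by exists phi.
case: eqP => [|_]; last by eexists.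
(* A zero SR1 denominator means p^T H p = - p^T g, which is the unit step. *)
rewrite {1}/qform mulmxBl dotDr dotNr -/(qform H (p j)) -/(qform (B j) (p j)).
rewrite BE opprK => /eqP; rewrite addr_eq0 => /eqP HE; case: nSR1; split=> //.
by rewrite /exact_step -mulNr -HE divff.
Qed.
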